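(* Let $N\ge2$ and let $(A_1,\dots,A_N)$ be nonnegative random variables satisfying $P\{\sum_{i}\mathbf{1}\{A_i>0\}\in\{0,1\}\}<1$, $\mathbb{E}[\sum_i\mathbf{1}\{A_i>0\}]>1$, $P\{A_i\in\{0,1\}\ \forall i\}<1$. Let $\phi(t,\xi)$ be the solution of the Cauchy problem described in the context with initial characteristic function $\phi_0$ of a distribution function $F_0$. Assume $F_0$ satisfies $(\mathbf{H}_\gamma)$ (see context) for some $\gamma\in(0,2]$. If $\mu(\delta)<\mu(\gamma)<+\infty$ for some $0<\delta<\gamma$, then $\lim_{t\to+\infty}\phi(t,e^{-t\mu(\gamma)}\xi)=1$ for every $\xi\in\mathbb{R}$.
   Context: $\mathcal{Q}(s)=\mathbb{E}[\sum_{j=1}^N A_j^s]-1$ for $s\ge0$ (convention $0^0=0$), $\mu(s)=\mathcal{Q}(s)/s$. Cauchy problem: for each $t\ge0$, $\phi(t,\cdot)$ is a characteristic function, $\partial_t\phi(t,\xi)+\phi(t,\xi)=\mathbb{E}[\prod_{i=1}^N\phi(t,A_i\xi)]$ for $t>0,\xi\in\mathbb{R}$, $\phi(0,\cdot)=\phi_0$ (unique solution). Hypothesis $(\mathbf{H}_\gamma)$: if $\gamma=1$: either (a) $\int|v|dF_0(v)<\infty$, or (b) $F_0$ symmetric with $\lim_{x\to+\infty}x(1-F_0(x))=c_0^+=\lim_{x\to-\infty}|x|F_0(x)$, $0<c_0^+<\infty$. If $\gamma=2$: $0<\int v^2dF_0(v)<\infty$ and $\int v\,dF_0(v)=0$.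 If $\gamma\in(0,1)\cup(1,2)$: $\lim_{x\to+\infty}x^\gamma(1-F_0(x))=c_0^+<\infty$, $\lim_{x\to-\infty}|x|^\gamma F_0(x)=c_0^-<\infty$, $c_0^++c_0^->0$, and $\int v\,dF_0(v)=0$ if $\gamma>1$. *)

(* Defs.v *)
From mathcomp Require Import all_boot all_algebra.
From mathcomp Require Import all_classical all_reals all_analysis.
From mathcomp Require Import complex.
Set Implicit Arguments. Unset Strict Implicit. Unset Printing Implicit Defensive.
Import GRing.Theory Num.Theory.
Import numFieldNormedType.Exports.
Local Open Scope classical_set_scope.
Local Open Scope ring_scope.
Local Open Scope complex_scope.

Section Defs.
Variable R : realType.

(* a^s with the convention 0^0 = 0 (and 0^s = 0 for all s) *)
Definition pw (a s : R) : R := if a == 0 then 0 else a `^ s.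

Section RV.
Variables (d : measure_display) (T : measurableType d) (P : probability T R).
Variables (N : nat) (A : 'I_N -> T -> R).

Definition npos (w : T) : nat := (\sum_(i < N) nat_of_bool (0 < A i w)%R)%N.

Definition Qfun (s : R) : \bar R :=
  (\int[P]_w (\sum_(i < N) pw (A i w) s)%:E - 1)%E.

Definition mufun (s : R) : \bar R := (Qfun s * (s^-1)%:E)%E.

Definition cexpect (f : T -> R[i]) : R[i] :=
  Rintegral P setT (fun w => complex.Re (f w)) +i*
  Rintegral P setT (fun w => complex.Im (f w)).

End RV.

Definition charfun (nu : probability R R) (xi : R) : R[i] :=
  Rintegral nu setT (fun v => cos (xi * v)) +i*
  Rintegral nu setT (fun v => sin (xi * v)).

Definition cdf (nu : probability R R) (x : R) : R := fine (nu [set v | v <= x]).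

Definition symmetric_law (nu : probability R R) : Prop :=
  forall B : set R, measurable B -> nu ((fun v => - v) @^-1` B) = nu B.

Definition H_gamma (nu : probability R R) (gamma : R) : Prop :=
  (gamma = 1 ->
     (\int[nu]_v (`|v|)%:E < +oo)%E
     \/ (symmetric_law nu /\
         exists c0 : R, 0 < c0 /\
           (x * (1 - cdf nu x)) @[x --> +oo] --> c0 /\
           (`|x| * cdf nu x) @[x --> -oo] --> c0)) /\
  (gamma = 2 ->
     (0 < \int[nu]_v (v ^+ 2)%:E)%E /\ (\int[nu]_v (v ^+ 2)%:E < +oo)%E /\
     (\int[nu]_v v%:E = 0)%E) /\
  (gamma <> 1 -> gamma <> 2 ->
     exists cp cm : R,
       (x `^ gamma * (1 - cdf nu x)) @[x --> +oo] --> cp /\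
       ((- x) `^ gamma * cdf nu x) @[x --> -oo] --> cm /\
       0 < cp + cm /\
       (1 < gamma -> (\int[nu]_v v%:E = 0)%E)).

Definition kac_solution (d : measure_display) (T : measurableType d)
  (P : probability T R) (N : nat) (A : 'I_N -> T -> R)
  (nu0 : probability R R) (phi : R -> R -> R[i]) : Prop :=
  (forall t : R, 0 <= t -> exists nu : probability R R, forall xi, phi t xi = charfun nu xi) /\
  (forall xi, phi 0 xi = charfun nu0 xi) /\
  (forall xi, complex.Re (phi t xi) @[t --> 0^'+] --> complex.Re (phi 0 xi) /\
              complex.Im (phi t xi) @[t --> 0^'+] --> complex.Im (phi 0 xi)) /\
  (forall (t xi : R), 0 < t ->
     exists dre dim : R,
       is_derive t (1:R) (fun s => complex.Re (phi s xi)) dre /\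
       is_derive t (1:R) (fun s => complex.Im (phi s xi)) dim /\
       (dre +i* dim) + phi t xi =
         cexpect P (fun w => \prod_(i < N) phi t (A i w * xi))).

End Defs.

(* Main.v *)
(* Let [S(w)] be the sum of the [A_i(w)^delta] and [q = E[S] - 1].  The moment of
   order [delta] of [F_0] is finite, and its mean is [0] when [delta > 1], so that
   [|phi_0(xi) - 1| <= C |xi|^delta].  Since [|prod z_i - 1| <= sum |z_i - 1|] in the
   unit disc, [C |xi|^delta e^(q t)], which solves the linearized equation, dominates
   [|phi(t, xi) - 1|].  At [e^(- t mu(gamma)) xi] the bound is
   [C |xi|^delta e^(t delta (mu(delta) - mu(gamma)))], which tends to [0]. *)
Require Import Defs.
From mathcomp Require Import all_boot all_order all_algebra.
From mathcomp Require Import all_classical all_reals all_analysis.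
From mathcomp Require Import measurable_realfun complex.
From mathcomp Require Import ring lra.
Set Implicit Arguments. Unset Strict Implicit. Unset Printing Implicit Defensive.
Import Order.TTheory GRing.Theory Num.Theory.
Import numFieldNormedType.Exports.
Local Open Scope classical_set_scope.
Local Open Scope ring_scope.
Local Open Scope complex_scope.
Local Notation normc := ComplexField.Normc.normc.

(** * Modulus of complex numbers and products in the unit disc *)

Section ComplexModulus.
Variable R : realType.
Implicit Types z : R[i].

Lemma normc_ge0 z : 0 <= normc z.
Proof. by case: z => a b; exact: sqrtr_ge0. Qed.

Lemma normcD z z' : normc (z + z') <= normc z + normc z'.
Proof. exact: (@le_normcD R z z'). Qed.

(** Cauchy-Schwarz, from Lagrange's identity [(a^2 + b^2)(x^2 + y^2) = (a x + b y)^2 + (a y - b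
    x)^2]. With its converse below it trades a modulus for the real forms [a Re + b Im], on which
    integrals and derivatives act directly. *)
Lemma unit_dot_le_normc (a b : R) z :
  a ^+ 2 + b ^+ 2 = 1 -> a * complex.Re z + b * complex.Im z <= normc z.
Proof.
case: z => x y /= ab.
have [h|h] := leP (a * x + b * y) 0; first exact: le_trans h (sqrtr_ge0 _).
rewrite -(ger0_norm (ltW h)) -sqrtr_sqr; apply: ler_wsqrtr.
have : 0 <= (a * y - b * x) ^+ 2 := sqr_ge0 _.
have -> : x ^+ 2 + y ^+ 2 = (a ^+ 2 + b ^+ 2) * (x ^+ 2 + y ^+ 2).
  by rewrite ab mul1r.
nra.
Qed.

(** The direction [z / |z|] attains the modulus. *)
Lemma normc_le_unit_dot z (c : R) :
  (forall a b : R, a ^+ 2 + b ^+ 2 = 1 ->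
     a * complex.Re z + b * complex.Im z <= c) ->
  normc z <= c.
Proof.
move=> H.
(* At [z = 0] there is no direction to normalise; two opposite ones give [0 <= c]. *)
have [/eqP n0|n0] := boolP (normc z == 0).
  have := H 1 0; have := H (-1) 0; move: n0.
  case: z {H} => x y /= -> H1 H2.
  have := H1 ltac:(by ring); have := H2 ltac:(by ring); lra.
have n2 : complex.Re z ^+ 2 + complex.Im z ^+ 2 = normc z ^+ 2.
  by case: (z) => x y /=; rewrite sqr_sqrtr// addr_ge0// sqr_ge0.
have := H (complex.Re z / normc z) (complex.Im z / normc z).
rewrite !expr_div_n -mulrDl n2 divff ?sqrf_eq0// => /(_ erefl).
suff -> : complex.Re z / normc z * complex.Re z +
    complex.Im z / normc z * complex.Im z = normc z by [].
transitivity ((complex.Re z ^+ 2 + complex.Im z ^+ 2) / normc z); first by ring.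
by rewrite n2 expr2 mulfK.
Qed.

Lemma normc_le_abs z : normc z <= `|complex.Re z| + `|complex.Im z|.
Proof.
case: z => x y /=; rewrite -[leRHS]ger0_norm ?addr_ge0// -sqrtr_sqr.
apply: ler_wsqrtr; rewrite sqrrD !real_normK ?num_real//.
by rewrite -subr_ge0; have := mulr_ge0 (normr_ge0 x) (normr_ge0 y); lra.
Qed.

Lemma abs_Re_le_normc z : `|complex.Re z| <= normc z.
Proof. by case: z => x y /=; rewrite -sqrtr_sqr ler_wsqrtr// lerDl sqr_ge0. Qed.

Lemma abs_Im_le_normc z : `|complex.Im z| <= normc z.
Proof. by case: z => x y /=; rewrite -sqrtr_sqr ler_wsqrtr// lerDr sqr_ge0. Qed.

Lemma normc_prod_le1 (I : finType) (F : I -> R[i]) :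
  (forall i, normc (F i) <= 1) -> normc (\prod_i F i) <= 1.
Proof.
move=> F1; elim/big_ind: _ => //; first by rewrite ComplexField.Normc.normc1.
by move=> x y x1 y1; rewrite ComplexField.Normc.normcM mulr_ile1 ?normc_ge0.
Qed.

(** Peel off one factor: [F z - 1 = (F - 1) + F (z - 1)], where [|F| <= 1] discards the coefficient
    of [z - 1]. *)
Lemma normc_prod_sub1 (I : finType) (F : I -> R[i]) :
  (forall i, normc (F i) <= 1) ->
  normc (\prod_i F i - 1) <= \sum_i normc (F i - 1).
Proof.
move=> F1.
suff [] : normc (\prod_i F i - 1) <= \sum_i normc (F i - 1) /\
          normc (\prod_i F i) <= 1 by [].
elim/big_rec2: _ => [|i x z _ [h1 h2]].
  by rewrite subrr ComplexField.Normc.normc0 ComplexField.Normc.normc1.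
split; last by rewrite ComplexField.Normc.normcM mulr_ile1 ?normc_ge0.
have -> : F i * z - 1 = (F i - 1) + F i * (z - 1).
  by ring.
apply: le_trans (normcD _ _) _; rewrite lerD2l ComplexField.Normc.normcM.
by apply: le_trans h1; rewrite ler_piMl ?normc_ge0.
Qed.

End ComplexModulus.

(** * Power bounds for sine and cosine *)

Section Trigonometry.
Variable R : realType.
Implicit Types x : R.

Lemma abs_sin_le x : `|sin x| <= `|x|.
Proof.
wlog x0 : x / 0 <= x => [H|].
  have [/H//|/ltW x0] := leP 0 x.
  by have := H (- x); rewrite sinN !normrN oppr_ge0; apply.
have dsin (y : R) : y \in `]0, x[ -> is_derive y 1 (@sin R) (cos y).
  by move=> _; exact: is_derive_sin.
have csin : {within `[0, x], continuous (@sin R)}.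
  by apply: continuous_subspaceT => y; exact: continuous_sin.
have [c _] := MVT_segment x0 dsin csin.
rewrite sin0 !subr0 => ->; rewrite normrM.
by rewrite ler_piMl// cos_max.
Qed.

(** Half-angle formula [1 - cos x = 2 sin^2 (x/2)], then [|sin y| <= |y|]. *)
Lemma cos_ge_quadratic x : 1 - cos x <= x ^+ 2 / 2.
Proof.
rewrite (_ : x = (x / 2) *+ 2); last by rewrite -mulr_natr divfK.
set y := x / 2; rewrite cos_mulr2n cos2sin2 -(mulr_natr y) -(mulr_natr (1 - _)).
have : sin y ^+ 2 <= y ^+ 2.
  by rewrite -[leLHS]real_normK ?num_real// -[leRHS]real_normK ?num_real//
    lerXn2r ?nnegrE// abs_sin_le.
have -> : (y * 2%:R) ^+ 2 / 2 = 2 * y ^+ 2 by field.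
move: (sin y ^+ 2) (y ^+ 2) => u v; lra.
Qed.

(** Mean value theorem for [sin y - y]: its derivative at [c] in []0, x[] has size
    [1 - cos c <= c^2 / 2 <= x]. Order 2 is enough, since only exponents [s <= 2] occur below. *)
Lemma abs_sin_sub_le x : `|x| <= 1 -> `|sin x - x| <= `|x| ^+ 2.
Proof.
wlog x0 : x / 0 <= x => [H|].
  have [/H//|/ltW x0] := leP 0 x.
  by have := H (- x); rewrite sinN -opprD !normrN oppr_ge0; apply.
rewrite (ger0_norm x0) => x1.
have dsin (y : R) : y \in `]0, x[ -> is_derive y 1 (fun y : R => sin y - y) (cos y - 1).
  by move=> _; apply: is_deriveB.
have csin : {within `[0, x], continuous (fun y : R => sin y - y)}.
  apply: continuous_subspaceT => y; apply: cvgB; last exact: cvg_id.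
  exact: continuous_sin.
have [c] := MVT_segment x0 dsin csin.
rewrite in_itv/= sin0 !subr0 => /andP[c0 cx] ->.
rewrite normrM (ger0_norm x0) expr2 ler_wpM2r//.
rewrite distrC ger0_norm ?subr_ge0 ?cos_le1//.
by apply: le_trans (cos_ge_quadratic _) _; nra.
Qed.

Variable s : R.
Hypothesis s_gt0 : 0 < s.

Lemma powR_abs_ge1 x : 1 <= `|x| -> 1 <= `|x| `^ s.
Proof. by move=> x1; rewrite -[leLHS](powRr0 `|x|) ler_powR// ltW. Qed.

(** This and the next two bounds split at [|x| = 1]. Beyond it [|x|^s >= 1] absorbs the bounded
    trigonometric terms; inside it a Taylor bound is weakened, as lowering an exponent increases the
    power. *)
Lemma cos_sub1_le_powR x : s <= 2 -> `|1 - cos x| <= 2 * `|x| `^ s.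
Proof.
move=> s2; rewrite ger0_norm ?subr_ge0 ?cos_le1//.
have [x1|x1] := leP 1 `|x|.
  by have := powR_abs_ge1 x1; have := cos_geN1 x; lra.
(* Comparing exponents on []0, 1]] needs a positive base, so [0] is treated apart. *)
have [->|x0] := eqVneq x 0; first by rewrite cos0 subrr mulr_ge0 ?powR_ge0.
apply: le_trans (cos_ge_quadratic _) _.
rewrite -[x ^+ 2]real_normK ?num_real// -powR_mulrn//.
have : `|x| `^ 2%:R <= `|x| `^ s by rewrite ger_powR// normr_gt0 x0/= ltW.
have := powR_ge0 `|x| s; lra.
Qed.

Lemma sin_le_powR x : s <= 1 -> `|sin x| <= 2 * `|x| `^ s.
Proof.
move=> s1; have [x1|x1] := leP 1 `|x|.
  by have := powR_abs_ge1 x1; have := sin_max x; lra.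
have [->|x0] := eqVneq x 0; first by rewrite sin0 normr0 mulr_ge0 ?powR_ge0.
apply: le_trans (abs_sin_le _) _.
have : `|x| <= `|x| `^ s by rewrite ger1_powR// normr_gt0 x0/= ltW.
have := powR_ge0 `|x| s; lra.
Qed.

Lemma sin_sub_le_powR x : 1 <= s -> s <= 2 -> `|sin x - x| <= 2 * `|x| `^ s.
Proof.
move=> s1 s2; have [x1|x1] := leP 1 `|x|.
  apply: le_trans (ler_normB _ _) _.
  by have := powR_abs_ge1 x1; have := sin_max x; have := le1r_powR x1 s1; lra.
have [->|x0] := eqVneq x 0.
  by rewrite sin0 subrr normr0 mulr_ge0 ?powR_ge0.
apply: le_trans (abs_sin_sub_le (ltW x1)) _.
rewrite -powR_mulrn//.
have : `|x| `^ 2%:R <= `|x| `^ s by rewrite ger_powR// normr_gt0 x0/= ltW.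
have := powR_ge0 `|x| s; lra.
Qed.

End Trigonometry.

(** * Characteristic functions: modulus, continuity, behaviour at the origin *)

Section CharacteristicFunctions.
Variables (R : realType).

Lemma bounded_integrable d (T : measurableType d) (P : probability T R)
    (f : T -> R) (M : R) :
  measurable_fun setT f -> (forall x, `|f x| <= M) ->
  P.-integrable setT (EFin \o f).
Proof.
move=> mf fM; apply: measurable_bounded_integrable => //.
  by apply: (le_lt_trans (probability_le1 P _)); rewrite ?ltry.
exists M; split; first exact: num_real.
by move=> y My x _; exact: le_trans (fM x) (ltW My).
Qed.

Variable nu : probability R R.

Lemma measurable_cosM (xi : R) : measurable_fun setT (fun v : R => cos (xi * v)).
Proof.
apply: continuous_measurable_fun => x.
by apply: (@continuous_comp _ _ _ (fun v : R => xi * v) (@cos R));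
  [exact: mulrl_continuous|exact: continuous_cos].
Qed.

Lemma measurable_sinM (xi : R) : measurable_fun setT (fun v : R => sin (xi * v)).
Proof.
apply: continuous_measurable_fun => x.
by apply: (@continuous_comp _ _ _ (fun v : R => xi * v) (@sin R));
  [exact: mulrl_continuous|exact: continuous_sin].
Qed.

Lemma integrable_cosM (xi : R) :
  nu.-integrable setT (EFin \o (fun v => cos (xi * v))).
Proof.
by apply: (bounded_integrable nu (measurable_cosM xi)) => x; exact: cos_max.
Qed.

Lemma integrable_sinM (xi : R) :
  nu.-integrable setT (EFin \o (fun v => sin (xi * v))).
Proof.
by apply: (bounded_integrable nu (measurable_sinM xi)) => x; exact: sin_max.
Qed.

Lemma Rintegral_prob_cst d (T : measurableType d) (P : probability T R) (c : R) :
  Rintegral P setT (fun=> c) = c.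
Proof. by rewrite Rintegral_cst//; have /= -> := probability_setT P; rewrite mulr1. Qed.

Lemma integrable_prob_cst d (T : measurableType d) (P : probability T R) (c : R) :
  P.-integrable setT (EFin \o (fun _ : T => c)).
Proof. by apply: (@bounded_integrable _ _ _ _ `|c|). Qed.

(** In a unit direction [(a, b)] the integrand [a cos + b sin] is at most [1], and [nu] has mass
    [1]. *)
Lemma normc_charfun_le1 (xi : R) : normc (charfun nu xi) <= 1.
Proof.
apply: normc_le_unit_dot => a b ab /=.
rewrite -RintegralZl//; last exact: integrable_cosM.
rewrite -RintegralZl//; last exact: integrable_sinM.
have icos c : nu.-integrable setT (EFin \o (fun v => c * cos (xi * v))).
  exact: integrableZl (integrable_cosM xi).
have isin c : nu.-integrable setT (EFin \o (fun v => c * sin (xi * v))).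
  exact: integrableZl (integrable_sinM xi).
rewrite -RintegralD// -[leRHS](Rintegral_prob_cst nu 1).
apply: le_Rintegral => //.
- exact: (integrableD measurableT (icos a) (isin b)).
- exact: integrable_prob_cst.
move=> x _; apply: le_trans (unit_dot_le_normc (_ +i* _) ab) _ => /=.
by rewrite cos2Dsin2 sqrtr1.
Qed.

(** Dominated convergence with the constant [1]. Continuity in [xi] is what later makes
    [phi t (A i w * xi)] measurable in [w]. *)
Lemma continuous_Re_charfun : continuous (fun xi => complex.Re (charfun nu xi)).
Proof.
move=> xi; apply: (@continuity_under_integral _ _ _ nu
  (fun xi v => cos (xi * v)) setT measurableT (xi - 1) (xi + 1) _ _ (fun=> 1)).
- by move=> x _; exact: integrable_cosM.
- apply: aeW => y _ x _.
  by apply: (@continuous_comp _ _ _ (fun v : R => v * y) (@cos R));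
    [exact: mulrr_continuous|exact: continuous_cos].
- exact: integrable_prob_cst.
- by move=> x _; apply: aeW => y _; exact: cos_max.
- by rewrite inE/= in_itv/=; lra.
Qed.

Lemma continuous_Im_charfun : continuous (fun xi => complex.Im (charfun nu xi)).
Proof.
move=> xi; apply: (@continuity_under_integral _ _ _ nu
  (fun xi v => sin (xi * v)) setT measurableT (xi - 1) (xi + 1) _ _ (fun=> 1)).
- by move=> x _; exact: integrable_sinM.
- apply: aeW => y _ x _.
  by apply: (@continuous_comp _ _ _ (fun v : R => v * y) (@sin R));
    [exact: mulrr_continuous|exact: continuous_sin].
- exact: integrable_prob_cst.
- by move=> x _; apply: aeW => y _; exact: sin_max.
- by rewrite inE/= in_itv/=; lra.
Qed.

Lemma measurable_abs_powR (s : R) : measurable_fun setT (fun v : R => `|v| `^ s).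
Proof.
by apply: (measurableT_comp (@measurable_powR R s)); exact: normr_measurable.
Qed.

(** The bound [2 |xi v|^s] holds for [1 - cos (xi v)], and for [sin (xi v)] when [s <= 1]. For
    [s > 1] the sine is too large near [0], but the vanishing mean allows integrating
    [sin (xi v) - xi v] instead. *)
Lemma charfun_sub1_le (s : R) : 0 < s <= 2 ->
  (\int[nu]_v (`|v| `^ s)%:E < +oo)%E ->
  (1 < s -> (\int[nu]_v v%:E = 0)%E) ->
  exists2 C : R, 0 <= C &
    forall xi, normc (charfun nu xi - 1) <= C * `|xi| `^ s.
Proof.
move=> /andP[s0 s2] mom mean.
set m := Rintegral nu setT (fun v => `|v| `^ s).
have ipow c : nu.-integrable setT (EFin \o (fun v => c * `|v| `^ s)).
  apply: (@integrableZl _ _ _ nu setT measurableT c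
    (EFin \o (fun v => `|v| `^ s))).
  apply/integrableP; split.
    by apply/measurable_EFinP; exact: measurable_abs_powR.
  by under eq_integral => x _ do rewrite /= ger0_norm ?powR_ge0//.
have bound xi (f : R -> R) : nu.-integrable setT (EFin \o f) ->
    (forall v, `|f v| <= 2 * `|xi * v| `^ s) ->
    `|Rintegral nu setT f| <= 2 * m * `|xi| `^ s.
  move=> ifn fb; apply: le_trans (le_normr_Rintegral _ ifn) _ => //.
  have -> : 2 * m * `|xi| `^ s =
      Rintegral nu setT (fun v => (2 * `|xi| `^ s) * `|v| `^ s).
    rewrite RintegralZl//; first by rewrite mulrAC.
    by have := ipow 1; under eq_fun do rewrite mul1r.
  apply: le_Rintegral => //.
    by have := integrable_norm ifn.
  move=> v _; apply: le_trans (fb v) _.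
  by rewrite normrM powRM// mulrA.
(* One [2 m] for the real part and one for the imaginary part. *)
exists (2 * m + 2 * m).
  by rewrite addr_ge0// mulr_ge0// Rintegral_ge0// => v _; exact: powR_ge0.
move=> xi; apply: le_trans (normc_le_abs _) _ => /=.
rewrite mulrDl lerD//.
  rewrite -[X in _ - X](Rintegral_prob_cst nu 1) -RintegralB//;
    [|exact: integrable_cosM|exact: integrable_prob_cst].
  apply: bound => [|v].
    exact: (integrableB measurableT (integrable_cosM xi) (integrable_prob_cst nu 1)).
  by rewrite distrC; exact: cos_sub1_le_powR.
rewrite oppr0 addr0.
have [s1|s1] := leP s 1.
  apply: bound => [|v]; first exact: integrable_sinM.
  exact: sin_le_powR.
(* Domination by [|v| <= 1 + |v|^s], valid as [s > 1] here. *)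
have iid c : nu.-integrable setT (EFin \o (fun v => c * v)).
  apply: (@integrableZl _ _ _ nu setT measurableT c (EFin \o id)).
  apply: (le_integrable measurableT _ _
    (integrableD measurableT (integrable_prob_cst nu 1) (ipow 1))).
    exact/measurable_EFinP.
  move=> v _; rewrite /= lee_fin mul1r.
  rewrite (ger0_norm (addr_ge0 ler01 (powR_ge0 _ _))).
  have [v1|v1] := leP 1 `|v|.
    by have := le1r_powR v1 (ltW s1); lra.
  by have := powR_ge0 `|v| s; lra.
have -> : Rintegral nu setT (fun v => sin (xi * v)) =
    Rintegral nu setT (fun v => sin (xi * v) - xi * v).
  rewrite RintegralB//; last exact: integrable_sinM.
  rewrite RintegralZl//; last by have := iid 1; under eq_fun do rewrite mul1r.
  by rewrite {3}/Rintegral mean// mulr0 subr0.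
apply: bound => [|v].
  exact: (integrableB measurableT (integrable_sinM xi) (iid xi)).
by apply: sin_sub_le_powR => //; exact: ltW.
Qed.

End CharacteristicFunctions.

(** * Finite moments of order below [gamma] *)

Section Moments.
Variables (R : realType) (nu : probability R R).

Lemma moment_le (s p : R) : 0 < s <= p ->
  (\int[nu]_v (`|v| `^ p)%:E < +oo)%E -> (\int[nu]_v (`|v| `^ s)%:E < +oo)%E.
Proof.
move=> /andP[s0 sp] mom.
have mpow q : measurable_fun setT (EFin \o (fun v : R => `|v| `^ q)).
  by apply/measurable_EFinP; exact: measurable_abs_powR.
apply: (@le_lt_trans _ _ (\int[nu]_v (1%:E + (`|v| `^ p)%:E))%E).
  apply: ge0_le_integral => //.
  - exact: mpow.
  - by apply: emeasurable_funD => //; exact: mpow.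
  move=> v _; rewrite lee_fin.
  have [v1|v1] := leP 1 `|v|.
    by have := ler_powR v1 sp; lra.
  have : `|v| `^ s <= 1 `^ s.
    by apply: ge0_ler_powR; rewrite ?nnegrE// ltW.
  by rewrite powR1; have := powR_ge0 `|v| p; lra.
rewrite ge0_integralD//; last exact: mpow.
rewrite integral_cst// mul1e lte_add_pinfty//.
by apply: (le_lt_trans (probability_le1 nu _)); rewrite ?ltry.
Qed.

(** Open at [x] and closed at [-x], so that the two halves have measure exactly [1 - cdf x] and
    [cdf (-x)]. *)
Definition tail_set (x : R) : set R := `]x, +oo[%classic `|` `]-oo, - x]%classic.

Lemma measurable_tail_set (x : R) : measurable (tail_set x).
Proof. by apply: measurableU; exact: measurable_itv. Qed.

Lemma tail_set_le (x : R) :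
  (nu (tail_set x) <= (1 - Defs.cdf nu x + Defs.cdf nu (- x))%:E)%E.
Proof.
have cdfE y : (Defs.cdf nu y)%:E = nu `]-oo, y]%classic.
  have <- : [set v | v <= y] = `]-oo, y]%classic.
    by apply/seteqP; split => v /=; rewrite in_itv.
  rewrite /Defs.cdf fineK// fin_num_measure//.
  by have := measurable_itv `]-oo, y]; rewrite set_itvE.
apply: le_trans (measureU2 _ _ _) _; [exact: measurable_itv..|].
rewrite EFinD EFinB !cdfE leeD2r//.
by rewrite -probability_setC ?setCitvl//; exact: measurable_itv.
Qed.

(* The powers are compared on the dyadic shells [2^k x0 < |v| <= 2^(k+1) x0]. *)
Lemma abs_powR_le_shells (s x0 v : R) : 0 < s -> 0 < x0 ->
  ((`|v| `^ s)%:E <= (x0 `^ s)%:E +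
    \sum_(0 <= k <oo) ((2 ^+ k.+1 * x0) `^ s * \1_(tail_set (2 ^+ k * x0)) v)%:E)%E.
Proof.
move=> s0 x00.
have pos k : (0 <= ((2 ^+ k.+1 * x0) `^ s * \1_(tail_set (2 ^+ k * x0)) v)%:E)%E.
  by rewrite lee_fin mulr_ge0// powR_ge0.
have mono (y z : R) : 0 <= y -> y <= z -> y `^ s <= z `^ s.
  by move=> y0 yz; exact: (ge0_ler_powR (ltW s0) y0 (le_trans y0 yz) yz).
have [vx|xv] := leP `|v| x0.
  apply: (@le_trans _ _ (x0 `^ s)%:E); first by rewrite lee_fin mono.
  by rewrite leeDl// nneseries_ge0.
have ex : exists n, `|v| <= 2 ^+ n * x0.
  exists (Num.bound (`|v| / x0)).
  rewrite -ler_pdivrMr//; apply: le_trans (ltW (archi_boundP _)) _.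
    by rewrite divr_ge0// ltW.
  by rewrite -natrX ler_nat ltnW// ltn_expl.
(* The least [n] with [|v| <= 2^n x0] is not [0] because [x0 < |v|]; writing it [m.+1], minimality
   puts [|v|] beyond [2^m x0]. *)
case: (ex_minnP ex) => -[|m] vm mmin.
  by move: vm; rewrite expr0 mul1r leNgt xv.
have mv : 2 ^+ m * x0 < `|v|.
  by rewrite ltNge; apply/negP => /mmin; rewrite ltnn.
apply: (@le_trans _ _
  (\sum_(0 <= k < m.+1) ((2 ^+ k.+1 * x0) `^ s * \1_(tail_set (2 ^+ k * x0)) v)%:E)%E).
  rewrite big_nat_recr//=.
  apply: (@le_trans _ _
      ((2 ^+ m.+1 * x0) `^ s * \1_(tail_set (2 ^+ m * x0)) v)%:E); last first.
    by rewrite leeDr// sume_ge0.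
  rewrite lee_fin indicE mem_set ?mulr1 ?mono//.
  rewrite /tail_set /= !in_itv/= andbT.
  have [v0|v0] := leP 0 v; first by left; rewrite -(ger0_norm v0).
  by right; move: mv; rewrite ltr0_norm//; lra.
by apply: le_trans (nneseries_lim_ge _ _) _ => //; rewrite leeDr// lee_fin powR_ge0.
Qed.

(** Integrating the shell bound term by term and inserting the tail estimate leaves a geometric
    series of ratio [2^(s - gamma) < 1]. *)
Lemma tail_moment (s gamma C x0 : R) : 0 < s < gamma -> 0 < x0 -> 0 <= C ->
  (forall x, x0 <= x -> (nu (tail_set x) <= (C * x `^ (- gamma))%:E)%E) ->
  (\int[nu]_v (`|v| `^ s)%:E < +oo)%E.
Proof.
move=> /andP[s0 sg] x00 C0 tail.
pose c k := (2 ^+ k.+1 * x0) `^ s.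
pose f k v := (c k * \1_(tail_set (2 ^+ k * x0)) v)%:E : \bar R.
have c0 k : 0 <= c k by exact: powR_ge0.
have f0 k v : (0 <= f k v)%E by rewrite lee_fin mulr_ge0.
have mf k : measurable_fun setT (f k).
  apply/measurable_EFinP; apply: measurable_funM => //.
  by apply: measurable_indic; exact: measurable_tail_set.
have x1 k : x0 <= 2 ^+ k * x0 by apply: ler_peMl; [exact: ltW|rewrite exprn_ege1// ler1n].
have fint k : (\int[nu]_v f k v <= (c k * (C * (2 ^+ k * x0) `^ (- gamma)))%:E)%E.
  under eq_integral => v _ do rewrite /f EFinM.
  rewrite ge0_integralZl_EFin//; last first.
    by apply/measurable_EFinP/measurable_indic; exact: measurable_tail_set.
  rewrite integral_indic//; last exact: measurable_tail_set.
  by rewrite setIT EFinM lee_wpmul2l ?lee_fin// tail.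
pose q : R := 2 `^ (s - gamma).
have q1 : q < 1.
  rewrite /q -[s - gamma]opprB powRN invf_lt1 ?powR_gt0//.
  have sg0 : 0 < gamma - s by rewrite subr_gt0.
  have := gt0_ltr_powR sg0 (ler01 : 1 \in Num.nneg) (ler0n R 2) (ltr1n R 2).
  by rewrite powR1.
have q0 : 0 <= q by exact: powR_ge0.
(* [K] collects what does not depend on the shell; its factor [2^s] is the cost of taking the outer
   radius in the power and the inner one in the tail. *)
pose K := 2 `^ s * C * x0 `^ (s - gamma).
have K0 : 0 <= K by rewrite !mulr_ge0 ?powR_ge0.
have termE k : c k * (C * (2 ^+ k * x0) `^ (- gamma)) = K * q ^+ k.
  have pw2 : (2 ^+ k : R) = 2 `^ k%:R by rewrite powR_mulrn.
  rewrite /c exprS -mulrA powRM ?mulr_ge0 ?exprn_ge0 ?ltW//.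
  have y0 : 0 < 2 ^+ k * x0 by rewrite mulr_gt0// exprn_gt0.
  have -> : 2 `^ s * (2 ^+ k * x0) `^ s * (C * (2 ^+ k * x0) `^ (- gamma)) =
      2 `^ s * C * ((2 ^+ k * x0) `^ s * (2 ^+ k * x0) `^ (- gamma)) by ring.
  rewrite -powRD; last by rewrite (gt_eqF y0) implybT.
  rewrite powRM ?exprn_ge0 ?ltW// pw2 -powRrM mulrC -[k%:R * _]mulrC powRrM.
  by rewrite powR_mulrn// -/q /K; ring.
have mpow : measurable_fun setT (fun v : R => (`|v| `^ s)%:E).
  by apply/measurable_EFinP; exact: measurable_abs_powR.
have mseries : measurable_fun setT (fun v => \sum_(0 <= k <oo) f k v)%E.
  by apply: ge0_emeasurable_sum.
apply: (@le_lt_trans _ _ (\int[nu]_v ((x0 `^ s)%:E + \sum_(0 <= k <oo) f k v))%E).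
  apply: ge0_le_integral => //.
  - by apply: emeasurable_funD.
  by move=> v _; exact: abs_powR_le_shells.
rewrite ge0_integralD//; last 2 first.
- by move=> v _; rewrite lee_fin powR_ge0.
- by move=> v _; exact: nneseries_ge0.
rewrite lte_add_pinfty//.
  rewrite integral_cst// lte_mul_pinfty ?lee_fin ?powR_ge0//.
  by apply: (le_lt_trans (probability_le1 nu _)); rewrite ?ltry.
rewrite integral_nneseries//.
apply: (@le_lt_trans _ _ (K / (1 - q))%:E); last exact: ltry.
apply: lime_le.
  by apply: is_cvg_nneseries => k _ _; exact: integral_ge0.
apply: nearW => n.
apply: (@le_trans _ _ (\sum_(0 <= k < n) (K * q ^+ k)%:E)%E).
  by apply: lee_sum => k _; apply: le_trans (fint k) _; rewrite termE.
rewrite sumEFin lee_fin.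
have := congr1 (fun u : R^nat => u n) (geometric_seriesE K (negbT (lt_eqF q1))).
rewrite seriesEnat /= => ->.
apply: ler_wpM2r; first by rewrite invr_ge0 subr_ge0 ltW.
by rewrite ler_piMr// gerBl exprn_ge0.
Qed.

Lemma pinfty_cvg_bound (f : R -> R) (l : R) : f x @[x --> +oo] --> l ->
  exists M, forall x, M < x -> f x < l + 1.
Proof.
move=> fl; have : \forall x \near +oo, f x < l + 1.
  by apply: (cvgr_lt l fl); rewrite ltrDl.
by move=> -[M [_ HM]]; exists M.
Qed.

Lemma ninfty_cvg_bound (f : R -> R) (l : R) : f x @[x --> -oo] --> l ->
  exists M, forall x, x < M -> f x < l + 1.
Proof.
move=> fl; have : \forall x \near -oo, f x < l + 1.
  by apply: (cvgr_lt l fl); rewrite ltrDl.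
by move=> -[M [_ HM]]; exists M.
Qed.

Lemma cdf_cvg_moment (s gamma cp cm : R) : 0 < s < gamma ->
  (x `^ gamma * (1 - Defs.cdf nu x)) @[x --> +oo] --> cp ->
  ((- x) `^ gamma * Defs.cdf nu x) @[x --> -oo] --> cm ->
  (\int[nu]_v (`|v| `^ s)%:E < +oo)%E.
Proof.
move=> sg /pinfty_cvg_bound[Mp Hp] /ninfty_cvg_bound[Mm Hm].
(* Each tail times [x^gamma] is eventually below its limit plus [1]; the maximum with [0] gives
   [0 <= C]. *)
pose C := Num.max 0 ((cp + 1) + (cm + 1)).
(* From [x0] on, [x > 0], [x > Mp] and [-x < Mm]. *)
pose x0 := Num.max 1 (Num.max (Mp + 1) (1 - Mm)).
apply: (@tail_moment s gamma C x0) => //.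
- by rewrite lt_max ltr01.
- by rewrite le_max lexx.
move=> x; rewrite !ge_max => /andP[x1 /andP[xp xm]].
have xpos : 0 < x by lra.
apply: le_trans (tail_set_le _) _; rewrite lee_fin powRN.
rewrite ler_pdivlMr ?powR_gt0// mulrC mulrDr.
have := Hp x ltac:(lra); have := Hm (- x) ltac:(lra).
rewrite opprK => h1 h2.
apply: le_trans (_ : (cp + 1) + (cm + 1) <= _); first by lra.
by rewrite le_max lexx orbT.
Qed.

Lemma H_gamma_moment (gamma s : R) : H_gamma nu gamma -> 0 < s < gamma ->
  (\int[nu]_v (`|v| `^ s)%:E < +oo)%E.
Proof.
move=> [H1 [H2 H3]] sg; have /andP[s0 sltg] := sg.
have s0g : 0 < s <= gamma by rewrite s0 ltW.
have [g1|g1] := eqVneq gamma 1.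
  have [h|[_ [c0 [_ [hp hm]]]]] := H1 g1.
    apply: (moment_le s0g); rewrite g1.
    by under eq_integral => v _ do rewrite powRr1//.
  (* The symmetric alternative is the generic tail condition with exponent [1]; [powR x 1] equals
     [x] only for [x >= 0], so the limits are transferred near infinity. *)
  rewrite g1 in sg; apply: (cdf_cvg_moment sg).
    apply: cvg_trans hp; apply: near_eq_cvg.
    near=> x; have x0 : 0 <= x.
      by near: x; apply: nbhs_pinfty_ge; rewrite num_real.
    by rewrite powRr1.
  apply: cvg_trans hm; apply: near_eq_cvg.
  near=> x; have x0 : x <= 0.
    by near: x; apply: nbhs_ninfty_le; rewrite num_real.
  by rewrite powRr1 ?oppr_ge0// ler0_norm.
have [g2|g2] := eqVneq gamma 2.
  have [_ [h _]] := H2 g2.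
  apply: (moment_le s0g); rewrite g2.
  by under eq_integral => v _ do
    rewrite (powR_mulrn 2) ?normr_ge0// real_normK ?num_real//.
have [cp [cm [hp [hm _]]]] := H3 (elimN eqP g1) (elimN eqP g2).
exact: cdf_cvg_moment sg hp hm.
Unshelve. all: by end_near. Qed.

Lemma H_gamma_mean (gamma : R) : H_gamma nu gamma -> 1 < gamma ->
  (\int[nu]_v v%:E = 0)%E.
Proof.
move=> [_ [H2 H3]] g1.
have [g2|/eqP g2] := eqVneq gamma 2; first by have [_ []] := H2 g2.
by have [|? [? [_ [_ [_ ->]]]]] := H3 _ g2; first by move: g1 => /[swap] ->; rewrite ltxx.
Qed.

End Moments.

(** * Comparison principle for the operator [u' + u] *)

Section Comparison.
Variable R : realType.

(** Integrating factor: [e^s (x - y)] has derivative [e^s ((x' + x) - (y' + y)) <= 0]. At [0] only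
    right continuity of [x] is asked, which is what [kac_solution] provides. *)
Lemma derive_comparison (x y dy : R -> R) :
  x t @[t --> 0^'+] --> x 0 ->
  (forall t : R, is_derive t (1 : R) y (dy t)) ->
  (forall t : R, 0 < t -> exists2 dx : R, is_derive t (1 : R) x dx & dx + x t <= dy t + y t) ->
  x 0 <= y 0 -> forall t : R, 0 <= t -> x t <= y t.
Proof.
move=> x0 yd xd xy0 t; rewrite le_eqVlt => /predU1P[<-//|t0].
pose g s := expR s * (x s - y s).
have gd (s : R) : 0 < s -> exists2 dg : R, is_derive s (1 : R) g dg & dg <= 0.
  move=> s0; have [dx xs dxle] := xd _ s0; have ys := yd s.
  exists (expR s * (dx - dy s) + (x s - y s) * expR s); last first.
    by have := expR_gt0 s; nra.
  by have := is_deriveM (is_derive_expR s) (is_deriveB xs ys).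
have gcont (s : R) : 0 < s -> {for s, continuous g}.
  by move=> s0; have [dg [gs _] _] := gd _ s0; apply/differentiable_continuous/derivable1_diffP.
have ycont : y s @[s --> 0^'+] --> y 0.
  apply: cvg_at_right_filter; have [ys _] := yd 0.
  exact/differentiable_continuous/derivable1_diffP.
have g0 : g s @[s --> 0^'+] --> g 0.
  by apply: cvgM; [apply: cvg_at_right_filter; exact: continuous_expR|exact: cvgB].
have cg : {within `[0, t], continuous g}.
  apply/continuous_within_itvP => //; split => //.
    by move=> s; rewrite in_itv/= => /andP[s0 _]; exact: gcont.
  by apply: cvg_at_left_filter; exact: gcont.
have : g t <= g 0.
  apply: (@ler0_derive1_le_cc _ g 0 t) => //; rewrite ?in_itv/= ?lexx ?ltW//.
  - by move=> s /andP[s0 _]; have [dg []] := gd _ s0.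
  - by move=> s /andP[s0 _]; rewrite derive1E; have [dg [_ ->]] := gd _ s0.
rewrite /g expR0 mul1r => gt.
have {gt} : expR t * (x t - y t) <= 0 by apply: le_trans gt _; rewrite subr_le0.
by rewrite pmulr_rle0 ?expR_gt0// subr_le0.
Qed.

Lemma is_derive_expRMr (c q t : R) :
  is_derive t (1 : R) (fun s : R => c * expR (s * q)) (c * (q * expR (t * q))).
Proof.
have dq : is_derive t (1 : R) (fun s : R => s * q) q.
  apply: (is_derive_eq (is_deriveM (is_derive_id t (1 : R)) (is_derive_cst q t (1 : R)))).
  by rewrite scaler0 add0r /GRing.scale /= mulr1.
have := is_deriveZ c
  (@is_derive1_comp R expR (fun s : R => s * q) t _ _ (is_derive_expR (t * q)) dq).
by rewrite [q * _]mulrC.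
Qed.

End Comparison.

(** * Expectations of complex random variables *)

Section Expectation.
Variables (R : realType) (d : measure_display) (T : measurableType d).
Variable P : probability T R.

Lemma measurable_Re_Im_prod (I : Type) (s : seq I) (z : I -> T -> R[i]) :
  (forall i, measurable_fun setT (fun w => complex.Re (z i w))) ->
  (forall i, measurable_fun setT (fun w => complex.Im (z i w))) ->
  measurable_fun setT (fun w => complex.Re (\prod_(i <- s) z i w)) /\
  measurable_fun setT (fun w => complex.Im (\prod_(i <- s) z i w)).
Proof.
move=> mRe mIm; elim: s => [|i s [IHr IHi]].
  by split; under eq_fun do rewrite big_nil; exact: measurable_cst.
have ReM (u v : R[i]) : complex.Re (u * v) =
    complex.Re u * complex.Re v - complex.Im u * complex.Im v.
  by case: u v => [a b] [? ?].
have ImM (u v : R[i]) : complex.Im (u * v) =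
    complex.Re u * complex.Im v + complex.Im u * complex.Re v.
  by case: u v => [a b] [? ?].
split.
  under eq_fun do rewrite big_cons ReM.
  by apply: measurable_funB; exact: measurable_funM.
under eq_fun do rewrite big_cons ImM.
by apply: measurable_funD; exact: measurable_funM.
Qed.

(** Since [P] has mass [1], the constant [1] goes under the integral; in each unit direction the
    integrand is then at most [|F - 1| <= H]. *)
Lemma normc_cexpect_sub1 (F : T -> R[i]) (H : T -> R) :
  measurable_fun setT (fun w => complex.Re (F w)) ->
  measurable_fun setT (fun w => complex.Im (F w)) ->
  (forall w, normc (F w) <= 1) ->
  P.-integrable setT (EFin \o H) ->
  (forall w, normc (F w - 1) <= H w) ->
  normc (cexpect P F - 1) <= Rintegral P setT H.
Proof.
move=> mRe mIm F1 iH FH.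
have iRe : P.-integrable setT (EFin \o (fun w => complex.Re (F w))).
  apply: (bounded_integrable P (M := 1) mRe) => w.
  exact: le_trans (abs_Re_le_normc _) (F1 w).
have iIm : P.-integrable setT (EFin \o (fun w => complex.Im (F w))).
  apply: (bounded_integrable P (M := 1) mIm) => w.
  exact: le_trans (abs_Im_le_normc _) (F1 w).
have i1 := integrable_prob_cst P 1.
have iRe1 := integrableB measurableT iRe i1.
apply: normc_le_unit_dot => a b ab /=.
rewrite oppr0 addr0 -[X in _ - X](Rintegral_prob_cst P 1) -RintegralB//.
rewrite -RintegralZl// -RintegralZl//.
have iaRe := integrableZl measurableT a iRe1.
have ibIm := integrableZl measurableT b iIm.
rewrite -RintegralD//; apply: le_Rintegral => //.
  exact: (integrableD measurableT iaRe ibIm).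
move=> w _; apply: le_trans (FH w).
apply: le_trans (unit_dot_le_normc _ ab).
by case: (F w) => u v /=; rewrite oppr0 addr0.
Qed.

End Expectation.

(** * Domination of solutions of the Kac equation *)

Section KacEquation.
Variables (R : realType) (d : measure_display) (T : measurableType d).
Variables (P : probability T R) (N : nat) (A : 'I_N -> T -> R).
Variables (nu0 : probability R R) (phi : R -> R -> R[i]).
Hypothesis mA : forall i, measurable_fun setT (A i).
Hypothesis A0 : forall i w, 0 <= A i w.
Hypothesis sol : kac_solution P A nu0 phi.

Lemma kac_normc_le1 t xi : 0 <= t -> normc (phi t xi) <= 1.
Proof. by case: sol => + _ t0 => /(_ t t0)[nu ->]; exact: normc_charfun_le1. Qed.

Lemma kac_measurable_prod t xi : 0 <= t ->
  measurable_fun setT (fun w => complex.Re (\prod_(i < N) phi t (A i w * xi))) /\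
  measurable_fun setT (fun w => complex.Im (\prod_(i < N) phi t (A i w * xi))).
Proof.
case: sol => + _ t0 => /(_ t t0)[nu phiE].
have mAxi i : measurable_fun setT (fun w => A i w * xi).
  by apply: measurable_funM => //; exact: mA.
apply: measurable_Re_Im_prod => i; under eq_fun do rewrite phiE.
  apply: (measurableT_comp (f := fun y => complex.Re (charfun nu y)) _ (mAxi i)).
  by apply: continuous_measurable_fun; exact: continuous_Re_charfun.
apply: (measurableT_comp (f := fun y => complex.Im (charfun nu y)) _ (mAxi i)).
by apply: continuous_measurable_fun; exact: continuous_Im_charfun.
Qed.

Variable s : R.
Hypothesis s0 : 0 < s.
Let S w := \sum_(i < N) pw (A i w) s.
Hypothesis iS : P.-integrable setT (EFin \o S).
Let q := Rintegral P setT S - 1.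

(** The product bound dominates the integrand by [sum_i (c |A_i xi|^s + B) = c |xi|^s S + N B], and
    [E[S] = q + 1]. The constant [B] stands for the error that [kac_comparison] shrinks. *)
Lemma kac_collision_le t xi c B : 0 <= t ->
  (forall y, normc (phi t y - 1) <= c * `|y| `^ s + B) ->
  normc (cexpect P (fun w => \prod_(i < N) phi t (A i w * xi)) - 1) <=
    (q + 1) * (c * `|xi| `^ s) + N%:R * B.
Proof.
move=> t0 phiB; have [mRe mIm] := kac_measurable_prod xi t0.
have iH : P.-integrable setT (EFin \o (fun w => (c * `|xi| `^ s) * S w + N%:R * B)).
  have := integrableD measurableT (integrableZl measurableT (c * `|xi| `^ s) iS)
    (integrable_prob_cst P (N%:R * B)).
  exact.
have -> : (q + 1) * (c * `|xi| `^ s) + N%:R * B =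
    Rintegral P setT (fun w => (c * `|xi| `^ s) * S w + N%:R * B).
  rewrite RintegralD//.
  - by rewrite RintegralZl// Rintegral_prob_cst /q subrK mulrC.
  - exact: (integrableZl measurableT _ iS).
  - exact: integrable_prob_cst.
apply: normc_cexpect_sub1 => // w.
  by apply: normc_prod_le1 => i; exact: kac_normc_le1.
apply: le_trans (normc_prod_sub1 _) _; first by move=> i; exact: kac_normc_le1.
rewrite /S mulr_sumr mulr_natl -[X in B *+ X]card_ord -sumr_const -big_split/=.
apply: ler_sum => i _; apply: le_trans (phiB _) _; rewrite lerD2r.
rewrite normrM powRM// (ger0_norm (A0 i w)) /pw.
(* When [A i w = 0], the convention in [pw] agrees with [0^s = 0], as [s > 0]. *)
case: ifPn => [/eqP ->|_]; first by rewrite powR0 ?gt_eqF// mul0r !mulr0.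
by rewrite mulrA mulrAC -mulrA.
Qed.

(** The equation at [xi] involves [phi] at the points [A_i xi], so a comparison at one fixed [xi]
    does not close. A bound valid at all points is fed into the collision term, and comparison
    returns a sharper one. *)
Lemma kac_comparison (C : R) : 0 <= C ->
  (forall xi, normc (phi 0 xi - 1) <= C * `|xi| `^ s) ->
  forall t xi, 0 <= t -> normc (phi t xi - 1) <= C * `|xi| `^ s * expR (t * q).
Proof.
move=> C0 init.
(* [e^(t N)] solves [u' + u = (N + 1) u], while the collision term multiplies the error by [N]: the
   gain is [N / (N + 1)]. *)
pose r : R := N%:R / N.+1%:R.
(* The a priori bound [2] is improved by the factor [r < 1] at each use of the equation. *)
have iter n : forall t xi, 0 <= t -> normc (phi t xi - 1) <=
    C * `|xi| `^ s * expR (t * q) + 2 * r ^+ n * expR (t * N%:R).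
  elim: n => [|n IH] t xi t0.
    apply: (@le_trans _ _ 2).
      apply: le_trans (normcD _ _) _.
      rewrite (@normcN R) ComplexField.Normc.normc1.
      by have := kac_normc_le1 xi t0; lra.
    have e1 : 1 <= expR (t * N%:R) by rewrite -expR0 ler_expR mulr_ge0.
    by rewrite expr0; have := mulr_ge0 (mulr_ge0 C0 (powR_ge0 `|xi| s)) (expR_ge0 (t * q)); lra.
  (* Projecting on a fixed unit direction makes the comparison one of real functions. *)
  apply: normc_le_unit_dot => a b ab.
  pose x t := a * complex.Re (phi t xi - 1) + b * complex.Im (phi t xi - 1).
  pose y t := C * `|xi| `^ s * expR (t * q) + 2 * r ^+ n.+1 * expR (t * N%:R).
  pose dy t := C * `|xi| `^ s * (q * expR (t * q)) +
    2 * r ^+ n.+1 * (N%:R * expR (t * N%:R)).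
  have ReB1 (z : R[i]) : complex.Re (z - 1) = complex.Re z - 1 by case: z.
  have ImB1 (z : R[i]) : complex.Im (z - 1) = complex.Im z by case: z => ? ? /=; rewrite oppr0 addr0.
  apply: (@derive_comparison R x y dy) t0.
  - have [_ [_ [/(_ xi)[cRe cIm] _]]] := sol.
    rewrite /x; under eq_fun do rewrite ReB1 ImB1.
    rewrite ReB1 ImB1.
    apply: cvgD; apply: cvgM; [exact: cvg_cst| |exact: cvg_cst|exact: cIm].
    by apply: cvgB => //; exact: cvg_cst.
  - by move=> u; apply: is_deriveD; exact: is_derive_expRMr.
  - move=> u u0; have [_ [_ [_ /(_ u xi u0)[dre [dim [dRe [dIm eqn]]]]]]] := sol.
    exists (a * dre + b * dim).
      rewrite /x; under eq_fun do rewrite ReB1 ImB1.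
      have dRe1 := is_deriveB dRe (is_derive_cst (1 : R) u (1 : R)).
      have := is_deriveD (is_deriveZ a dRe1) (is_deriveZ b dIm).
      by rewrite subr0.
    set E := cexpect _ _ in eqn.
    have collision : normc (E - 1) <=
        (q + 1) * (C * expR (u * q) * `|xi| `^ s) +
        N%:R * (2 * r ^+ n * expR (u * N%:R)).
      apply: kac_collision_le (ltW u0) _ => z.
      by have := IH u z (ltW u0); rewrite mulrAC.
    have := unit_dot_le_normc (E - 1) ab.
    have -> : a * complex.Re (E - 1) + b * complex.Im (E - 1) =
        a * dre + b * dim + x u.
      rewrite /x !ReB1 !ImB1 -eqn; case: (phi u xi) => ? ? /=; ring.
    move=> /le_trans/(_ collision)/le_trans; apply.
    have -> : N%:R * (2 * r ^+ n * expR (u * N%:R)) =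
        (N%:R + 1) * (2 * r ^+ n.+1 * expR (u * N%:R)) :> R.
      transitivity ((N%:R + 1) * r * (2 * r ^+ n * expR (u * N%:R))).
        by rewrite natr1 [_ * r]mulrC divfK// pnatr_eq0.
      by rewrite exprS; ring.
    (* Equality: [y] is built so that [y' + y] is exactly the collision bound. *)
    rewrite /y /dy le_eqVlt; apply/orP; left; apply/eqP; ring.
  - apply: le_trans (unit_dot_le_normc _ ab) _.
    apply: le_trans (init xi) _.
    rewrite /y !mul0r expR0 !mulr1 lerDl mulr_ge0// exprn_ge0// divr_ge0//.
move=> t xi t0.
have r1 : `|r| < 1.
  by rewrite ger0_norm ?divr_ge0// ltr_pdivrMr ?mul1r ?ltr_nat.
(* At fixed [t] the error is geometric in [n] and disappears as [n] grows. *)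
have lim0 : (fun n => C * `|xi| `^ s * expR (t * q) +
    geometric (2 * expR (t * N%:R)) r n) @ \oo --> C * `|xi| `^ s * expR (t * q) + 0.
  by apply: cvgD; [exact: cvg_cst|exact: cvg_geometric].
rewrite -[leRHS]addr0 -(cvg_lim _ lim0)//.
apply: limr_ge; first by apply/cvg_ex; eexists; exact: lim0.
apply: nearW => n; apply: le_trans (iter n t xi t0) _.
by rewrite /geometric/= (mulrAC 2).
Qed.

End KacEquation.

(** * Finiteness of [mu(delta)] and exponential decay *)

Section Rescaling.
Variables (R : realType) (d : measure_display) (T : measurableType d).
Variables (P : probability T R) (N : nat) (A : 'I_N -> T -> R).
Hypothesis mA : forall i, measurable_fun setT (A i).

(** If [E[S] = +oo] then [mu(delta) = +oo], against [mu(delta) < mu(gamma) < +oo]. *)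
Lemma mufun_lt_integrable (delta gamma : R) : 0 < delta ->
  (mufun P A delta < mufun P A gamma)%E -> (mufun P A gamma < +oo)%E ->
  let S w := \sum_(i < N) pw (A i w) delta in
  P.-integrable setT (EFin \o S) /\
  (Rintegral P setT S - 1) / delta < fine (mufun P A gamma).
Proof.
move=> delta0 mulow muoo S.
have S0 w : 0 <= S w.
  by apply: sumr_ge0 => i _; rewrite /pw; case: ifP => // _; exact: powR_ge0.
have mS : measurable_fun setT S.
  apply: measurable_sum => i; rewrite /pw.
  apply: measurable_fun_ifT => //.
    by apply: measurable_fun_eqr => //; exact: mA.
  by apply: (measurableT_comp (@measurable_powR R delta)); exact: mA.
have iS : P.-integrable setT (EFin \o S).
  apply/integrableP; split; first exact/measurable_EFinP.
  under eq_integral => w _ do rewrite /= ger0_norm//.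
  rewrite ltey; apply/eqP => Soo.
  have := lt_trans mulow muoo.
  rewrite /mufun /Qfun -/S Soo /= addye// mulyr gtr0_sg ?invr_gt0//.
  by rewrite mul1e ltxx.
split=> //.
have muE : mufun P A delta = ((Rintegral P setT S - 1) / delta)%:E.
  rewrite /mufun /Qfun /Rintegral EFinM EFinB fineK//.
  exact: integrable_fin_num iS.
(* [fine] sends infinite values to [0]; here [mu(gamma)] lies strictly above [mu(delta)] and below
   [+oo], so it is finite and the inequality survives. *)
rewrite -lte_fin -muE fineK// fin_real// muoo andbT.
by apply: le_lt_trans mulow; rewrite leNye.
Qed.

Lemma expR_scale_cvg0 (K k : R) : k < 0 ->
  K * expR (t * k) @[t --> +oo] --> 0.
Proof.
move=> k0; rewrite -[X in _ --> X](mulr0 K); apply: cvgM; first exact: cvg_cst.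
have kt : (fun t : R => t * - k) @ +oo --> +oo.
  by apply: gt0_cvgMly; [rewrite oppr_gt0|exact: cvg_id].
have := cvg_comp _ _ kt (@cvgr_expR R).
by rewrite /comp; under eq_fun do rewrite mulrN opprK.
Qed.

End Rescaling.

(** * Convergence of the rescaled solution *)

Theorem theorem2 (R : realType) (d : measure_display) (T : measurableType d)
  (P : probability T R) (N : nat) (A : 'I_N -> T -> R)
  (nu0 : probability R R) (phi : R -> R -> R[i]) (gamma : R) :
  (2 <= N)%N ->
  (forall i, measurable_fun setT (A i)) ->
  (forall i w, 0 <= A i w) ->
  (P [set w | (npos A w <= 1)%N] < 1)%E ->
  (1 < \int[P]_w ((npos A w)%:R)%:E)%E ->
  (P [set w | forall i, (A i w = 0 \/ A i w = 1)%R] < 1)%E ->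
  kac_solution P A nu0 phi ->
  0 < gamma <= 2 ->
  H_gamma nu0 gamma ->
  (exists delta : R, 0 < delta < gamma /\ (mufun P A delta < mufun P A gamma)%E) ->
  (mufun P A gamma < +oo)%E ->
  forall xi : R,
    (complex.Re (phi t (expR (- (t * fine (mufun P A gamma))) * xi)) @[t --> +oo] --> (1 : R)) /\
    (complex.Im (phi t (expR (- (t * fine (mufun P A gamma))) * xi)) @[t --> +oo] --> (0 : R)).
Proof.
move=> _ mA A0 _ _ _ sol /andP[_ gamma2] Hg [delta [deltag mulow]] muoo xi.
have /andP[delta0 ltdg] := deltag.
have [iS Slt] := mufun_lt_integrable mA delta0 mulow muoo.
set mu := fine _ in Slt *.
set q := Rintegral _ _ _ - 1 in Slt.
(* Here [delta < gamma <= 2], and [delta > 1] forces [gamma > 1], the range in which the mean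
   vanishes. *)
have [C C0 init] : exists2 C : R, 0 <= C &
    forall y, normc (charfun nu0 y - 1) <= C * `|y| `^ delta.
  apply: charfun_sub1_le.
  - by rewrite delta0; exact: le_trans (ltW ltdg) gamma2.
  - exact: H_gamma_moment Hg deltag.
  - by move=> delta1; apply: H_gamma_mean Hg _; exact: lt_trans ltdg.
have initphi y : normc (phi 0 y - 1) <= C * `|y| `^ delta.
  by have [_ [-> _]] := sol; exact: init.
(* As [q = delta mu(delta)], the rate is [delta (mu(delta) - mu(gamma))]. *)
have k0 : q - delta * mu < 0.
  by rewrite subr_lt0 mulrC -ltr_pdivrMr.
(* The rescaling contributes the factor [e^(- t delta mu)] through [|e^(- t mu) xi|^delta]. *)
have decay t : 0 <= t -> normc (phi t (expR (- (t * mu)) * xi) - 1) <=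
    C * `|xi| `^ delta * expR (t * (q - delta * mu)).
  move=> t0; apply: le_trans (kac_comparison mA A0 sol delta0 iS C0 initphi _ t0) _.
  rewrite normrM (ger0_norm (expR_ge0 _)) powRM ?expR_ge0// -/q.
  rewrite -expRM.
  have -> : t * (q - delta * mu) = - (t * mu) * delta + t * q by ring.
  by rewrite expRD le_eqVlt; apply/orP; left; apply/eqP; ring.
have lim0 := expR_scale_cvg0 (C * `|xi| `^ delta) k0.
have squeeze (f : R -> R) (l : R) :
    (forall t, 0 <= t -> `|f t - l| <= C * `|xi| `^ delta * expR (t * (q - delta * mu))) ->
    f t @[t --> +oo] --> l.
  move=> fl; apply/cvgrPdist_le => e e0.
  move/cvgrPdist_le : lim0 => /(_ e e0) lim0.
  near=> t; rewrite distrC; apply: le_trans (fl t _) _.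
    by near: t; apply: nbhs_pinfty_ge; rewrite num_real.
  apply: le_trans (ler_norm _) _; rewrite -normrN -sub0r.
  by near: t.
split; apply: squeeze => t t0; apply: le_trans (decay t t0).
  by apply: le_trans (abs_Re_le_normc _); case: (phi _ _).
by apply: le_trans (abs_Im_le_normc _); case: (phi _ _) => ? ? /=; rewrite oppr0 addr0.
Unshelve. all: by end_near. Qed.
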